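(* Let $p\ge 7$ be a prime, and let $A_{p-1}=\sum_{k=0}^{p-1}\binom{p-1}{k}^2\binom{p-1+k}{k}^2$. Then $$A_{p-1}\equiv 1+p^3\left(\frac{4}{3}B_{p-3}-\frac{1}{2}B_{2p-4}\right)+\frac{1}{9}p^4B_{p-3}\pmod{p^5}.$$
   Context: The Bernoulli numbers $B_n$ are defined by $\frac{x}{e^x-1}=\sum_{n=0}^{\infty}B_n\frac{x^n}{n!}$. For rational numbers $a,b$ whose denominators are prime to $p$, $a\equiv b\pmod{p^m}$ means that $a-b$ equals $p^m$ times a rational number with denominator prime to $p$. *)

(* Defs.v *)
From mathcomp Require Import all_boot all_order all_algebra.
Set Implicit Arguments. Unset Strict Implicit. Unset Printing Implicit Defensive.
Import Order.TTheory GRing.Theory Num.Theory.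
Local Open Scope ring_scope.

(* Bernoulli numbers B_n (rational), with x/(e^x-1) = sum B_n x^n/n!, i.e.
   B_0 = 1 and, for n >= 1, sum_{k=0}^{n} C(n+1,k) B_k = 0, so
   B_n = -1/(n+1) * sum_{k<n} C(n+1,k) B_k  (hence B_1 = -1/2). *)
Fixpoint bern_upto (n : nat) : seq rat :=
  match n with
  | 0 => [:: 1]
  | n'.+1 =>
      let s := bern_upto n' in
      rcons s (- (n'.+2%:R)^-1 *
                 \sum_(k < n'.+1) ('C(n'.+2, k))%:R * s`_k)
  end.

Definition bernoulli (n : nat) : rat := (bern_upto n)`_n.

Definition rat_congr_mod (p m : nat) (a b : rat) : Prop :=
  exists r : rat, ~~ (p %| `|denq r|)%N /\ a - b = (p ^ m)%:R * r.

Definition apery (n : nat) : nat :=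
  \sum_(k < n.+1) ('C(n, k) ^ 2 * 'C(n + k, k) ^ 2)%N.

(* Main.v *)
(** With H_s = sum_{0 < k < p} 1/k^s, the k-th term of the Apery sum, k > 0, is
    [p (p-k) / k^2 * prod_{j<k} (1 - p^2/j^2)]^2; expanding it p-adically and
    using H_2 = H_4 = 0 mod p and H_3 = 0 mod p^2 gives
    A_{p-1} = 1 + p^2 H_2 mod p^5. It remains to find H_2 mod p^3. Put
    S_n = sum_{0 < k < p} k^n and c_n = S_n / (n p). Comparing the residues 2k
    with the residues k yields
    (2^n - 1) S_n = sum_{m < p odd} [(m+p)^n - m^n], and a Taylor expansion turns
    this into Kummer's congruences for c_n, valid also for n = -2; in particular
    c_{-2} - 2 c_{p-3} + c_{2p-4} = 0 mod p^2, where c_{-2} = - H_2 / (2p).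
    Finally S_n = p B_n mod p^3 for n = p-3 and n = 2p-4 by Faulhaber's formula. *)
From HB Require Import structures.
Require Import Defs.
From mathcomp Require Import all_boot all_order all_algebra.
From mathcomp Require Import cyclic.
From mathcomp Require Import ring zify.
Import Order.TTheory GRing.Theory Num.Theory.
Local Open Scope ring_scope.
Set Implicit Arguments. Unset Strict Implicit. Unset Printing Implicit Defensive.

(** * p-local rationals *)

(* Z_(p); testing coprimality makes it a subring for every p, prime or not. *)
Definition plocal_pred (p : nat) : pred rat := fun x => coprime p `|denq x|.
Definition plocal (p : nat) := [qualify a x | plocal_pred p x].

Lemma plocal_frac (p : nat) (a : int) (b : nat) :
  coprime p b -> a%:~R / b%:R \is a plocal p.
Proof.
(* If b = 0, [coprime p 0] forces p = 1, and then every rational is p-local. *)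
case: (posnP b) => [->|b_gt0 pb].
  by rewrite /coprime gcdn0 => /eqP ->; rewrite qualifE /plocal_pred coprime1n.
set x := _ / _; suff dvd_xb : (`|denq x| %| b)%N by apply: coprime_dvdr pb.
have b0 : b%:R != 0 :> rat by rewrite pnatr_eq0 -lt0n.
have eqx : numq x * b = a * denq x.
  apply: (@intr_inj rat); rewrite !rmorphM /= numqE /x mulrAC -pmulrn.
  by rewrite divfK.
have : (`|denq x| %| `|(numq x * b)%R|)%N by rewrite eqx abszM dvdn_mull.
by rewrite abszM Gauss_dvdr // coprime_sym coprime_num_den.
Qed.

Lemma plocalP (p : nat) (x : rat) :
  reflect (exists a : int, exists2 b : nat, coprime p b & x = a%:~R / b%:R)
          (x \is a plocal p).
Proof.
apply: (iffP idP) => [px|[a [b pb ->]]]; last exact: plocal_frac.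
exists (numq x), `|denq x|%N; first exact: px.
by rewrite pmulrn absz_denq divq_num_den.
Qed.

Lemma plocal_subring_closed (p : nat) : subring_closed (plocal_pred p).
Proof.
split=> [|x y /plocalP[a [b pb ->]] /plocalP[c [d pd ->]]|
          x y /plocalP[a [b pb ->]] /plocalP[c [d pd ->]]].
- by rewrite unfold_in /plocal_pred coprimen1.
- have [b0|b0] := eqVneq b 0%N.
    by move: pb; rewrite b0 /coprime gcdn0 => /eqP ->; rewrite unfold_in /plocal_pred coprime1n.
  have [d0|d0] := eqVneq d 0%N.
    by move: pd; rewrite d0 /coprime gcdn0 => /eqP ->; rewrite unfold_in /plocal_pred coprime1n.
  have -> : a%:~R / b%:R - c%:~R / d%:R =
            (a * d - c * b)%:~R / (b * d)%:R :> rat.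
    by rewrite natrM rmorphB !rmorphM /= -!pmulrn; field; rewrite !pnatr_eq0 d0.
  by apply: plocal_frac; rewrite coprimeMr pb.
- have -> : a%:~R / b%:R * (c%:~R / d%:R) = (a * c)%:~R / (b * d)%:R :> rat.
    by rewrite natrM rmorphM invfM mulrACA.
  by apply: plocal_frac; rewrite coprimeMr pb.
Qed.

HB.instance Definition _ (p : nat) :=
  GRing.isSubringClosed.Build rat (plocal_pred p) (plocal_subring_closed p).

Lemma plocal_natV (p b : nat) : coprime p b -> b%:R^-1 \is a plocal p.
Proof. by move=> /(plocal_frac 1); rewrite mul1r. Qed.

(** The ideal p^m Z_(p); congruences mod p^m become memberships of differences. Division by zero
    gives 0, so for p = 0 and m > 0 this is all of Q, whence the hypotheses [0 < p] below. *)
Definition pideal_pred (p m : nat) : pred rat :=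
  fun x => x / p%:R ^+ m \is a plocal p.
Definition pideal (p m : nat) := [qualify a x | pideal_pred p m x].

Lemma pideal_zmod_closed (p m : nat) : zmod_closed (pideal_pred p m).
Proof.
split=> [|x y px py]; first by rewrite unfold_in /pideal_pred mul0r rpred0.
by rewrite unfold_in /pideal_pred mulrBl; apply: rpredB.
Qed.

HB.instance Definition _ (p m : nat) :=
  GRing.isZmodClosed.Build rat (pideal_pred p m) (pideal_zmod_closed p m).

Lemma pideal0 (p : nat) (x : rat) : (x \is a pideal p 0) = (x \is a plocal p).
Proof. by rewrite qualifE /pideal_pred expr0 divr1. Qed.

Lemma pidealM (p m n : nat) (x y : rat) :
  x \is a pideal p m -> y \is a pideal p n -> x * y \is a pideal p (m + n).
Proof.
by rewrite !qualifE /pideal_pred exprD invfM mulrACA; apply: rpredM.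
Qed.

Lemma pidealMr (p m : nat) (x y : rat) :
  x \is a pideal p m -> y \is a plocal p -> x * y \is a pideal p m.
Proof. by rewrite -pideal0 -{2}[m]addn0; apply: pidealM. Qed.

Lemma pidealMl (p m : nat) (x y : rat) :
  x \is a plocal p -> y \is a pideal p m -> x * y \is a pideal p m.
Proof. by rewrite -pideal0; apply: pidealM. Qed.

Lemma pideal_expn (p m : nat) : (0 < p)%N -> p%:R ^+ m \is a pideal p m.
Proof.
by move=> p0; rewrite qualifE /pideal_pred divff ?rpred1 // expf_neq0 // pnatr_eq0 -lt0n.
Qed.

Lemma pideal_sub (p m n : nat) (x : rat) : (0 < p)%N -> (m <= n)%N ->
  x \is a pideal p n -> x \is a pideal p m.
Proof.
move=> p0 mn; rewrite !qualifE /pideal_pred -(subnK mn) exprD => px.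
have p0' : p%:R != 0 :> rat by rewrite pnatr_eq0 -lt0n.
have -> : x / p%:R ^+ m = x / (p%:R ^+ (n - m) * p%:R ^+ m) * p%:R ^+ (n - m).
  by rewrite invfM mulrA mulrAC divfK // expf_neq0.
by rewrite rpredM // rpredX // rpred_nat.
Qed.

Lemma pideal_local (p m : nat) (x : rat) : (0 < p)%N ->
  x \is a pideal p m -> x \is a plocal p.
Proof. by move=> p0; rewrite -pideal0; apply: pideal_sub. Qed.

Lemma pidealMp (p m n : nat) (x : rat) : (0 < p)%N ->
  (p%:R ^+ n * x \is a pideal p (n + m)) = (x \is a pideal p m).
Proof.
move=> p0; rewrite !qualifE /pideal_pred exprD invfM mulrACA divff ?mul1r //.
by rewrite expf_neq0 // pnatr_eq0 -lt0n.
Qed.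

Lemma pidealP (p m : nat) (x : rat) : (0 < p)%N -> x \is a pideal p m ->
  exists2 r, r \is a plocal p & x = p%:R ^+ m * r.
Proof.
move=> p0 px; exists (x / p%:R ^+ m); first exact: px.
by rewrite mulrC divfK // expf_neq0 // pnatr_eq0 -lt0n.
Qed.

(** * Bernoulli numbers *)

Lemma size_bern_upto (n : nat) : size (bern_upto n) = n.+1.
Proof. by elim: n => //= n IHn; rewrite size_rcons IHn. Qed.

Lemma nth_bern_upto (n k : nat) : (k <= n)%N -> (bern_upto n)`_k = bernoulli k.
Proof.
elim: n => [|n IHn]; first by rewrite leqn0 => /eqP ->.
rewrite leq_eqVlt => /predU1P[-> //|ltkn].
by rewrite /= nth_rcons size_bern_upto ltkn IHn.
Qed.

Lemma sum_bin_bernoulli (n : nat) :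
  \sum_(i < n) 'C(n, i)%:R * bernoulli i = (n == 1)%:R.
Proof.
case: n => [|[|n]]; first by rewrite big_ord0.
  by rewrite big_ord1 bin0 mulr1.
rewrite big_ord_recr /= binSn /bernoulli /= nth_rcons size_bern_upto ltnn eqxx.
rewrite [X in X + _](eq_bigr (fun i : 'I__ => 'C(n.+2, i)%:R * (bern_upto n)`_i)).
  by rewrite mulrA mulrN divff ?pnatr_eq0 // mulN1r subrr.
by move=> i _; rewrite nth_bern_upto // -ltnS.
Qed.

(* The recursion for B_n says that this functional L : X^n |-> B_n satisfies
   L(q(X+1)) - L(q) = q'(0), from which Faulhaber's formula telescopes. *)
Definition umbral (q : {poly rat}) : rat := \sum_(i < size q) q`_i * bernoulli i.

Lemma umbral_widen (n : nat) (q : {poly rat}) : (size q <= n)%N ->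
  umbral q = \sum_(i < n) q`_i * bernoulli i.
Proof.
move=> leqn; rewrite /umbral (big_ord_widen _ (fun i => q`_i * bernoulli i) leqn).
rewrite [RHS](bigID (fun i : 'I_n => (i < size q)%N)) /= [X in _ + X]big1 ?addr0 //.
by move=> i; rewrite -leqNgt => /(nth_default 0) ->; rewrite mul0r.
Qed.

Lemma umbral_is_linear : linear_for *%R umbral.
Proof.
move=> a u v; set n := maxn (size u) (size v).
rewrite !(@umbral_widen n) ?leq_maxl ?leq_maxr //; last first.
  by rewrite (leq_trans (size_polyD _ _)) // geq_max leq_maxr
             (leq_trans (size_scale_leq _ _)) ?leq_maxl.
rewrite mulr_sumr -big_split /=; apply: eq_bigr => i _.
by rewrite coefD coefZ mulrDl mulrA.
Qed.

HB.instance Definition _ :=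
  GRing.isLinear.Build rat {poly rat} rat *%R umbral umbral_is_linear.

Lemma umbralXn (n : nat) : umbral 'X^n = bernoulli n.
Proof.
rewrite /umbral size_polyXn big_ord_recr /= coefXn eqxx mul1r big1 ?add0r //.
by move=> i _; rewrite coefXn (ltn_eqF (ltn_ord i)) mul0r.
Qed.

Lemma umbral_exprDC (n : nat) (c : rat) :
  umbral (('X + c%:P) ^+ n) =
  \sum_(i < n.+1) 'C(n, i)%:R * (bernoulli (n - i) * c ^+ i).
Proof.
rewrite exprDn raddf_sum /=; apply: eq_bigr => i _.
rewrite raddfMn /= -polyC_exp mulrC mul_polyC linearZ /= umbralXn.
by rewrite mulr_natl mulrC.
Qed.

(** By linearity it suffices to take q = X^n, where both sides equal [n = 1]: the left one by
    [sum_bin_bernoulli], the right one because only X has a nonzero derivative at 0. *)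
Lemma umbral_shift (q : {poly rat}) :
  umbral (q \Po ('X + 1)) - umbral q = q^`().[0].
Proof.
pose s := \sum_(i < size q) q`_i *: 'X^i.
have -> : q = s by rewrite /s -poly_def coefK.
rewrite {}/s linear_sum !(linear_sum umbral) linear_sum /= -sumrB horner_sum.
apply: eq_bigr => i _.
rewrite comp_polyZ comp_Xn_poly !linearZ /= umbralXn derivXn hornerZ -mulrBr.
congr (_ * _); have -> : 1 = 1%:P :> {poly rat} by [].
rewrite umbral_exprDC (reindex_inj rev_ord_inj) /= big_ord_recr /= subSS subnn.
rewrite bin0 subn0 expr0 mulr1 mul1r addrK.
rewrite (eq_bigr (fun j : 'I_i => 'C(i, j)%:R * bernoulli j)) => [|j _].
  rewrite sum_bin_bernoulli hornerMn hornerXn.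
  by case: (nat_of_ord i) => [|[|j]]; rewrite ?mulr0n ?expr0 // expr0n mul0rn.
have lji : (j <= i)%N by rewrite ltnW.
by rewrite subSS bin_sub // subKn // expr1n mulr1.
Qed.

(** Both sides times n+1 equal L((X+N)^(n+1)) - L(X^(n+1)) with L = [umbral]: on the left by
    induction on N through [umbral_shift], on the right by the binomial theorem and (n+1) C(n,k) =
    (k+1) C(n+1,k+1). *)
Lemma faulhaber (n N : nat) :
  \sum_(k < N) k%:R ^+ n =
  \sum_(k < n.+1) 'C(n, k)%:R * bernoulli (n - k) * (N%:R ^+ k.+1 / k.+1%:R).
Proof.
have n1 : n.+1%:R != 0 :> rat by rewrite pnatr_eq0.
apply: (mulfI n1); transitivity
    (umbral (('X + N%:R%:P) ^+ n.+1) - umbral ('X ^+ n.+1)).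
  elim: N => [|N IHN]; first by rewrite big_ord0 mulr0 addr0 subrr.
  set q := (_ + _) ^+ _ in IHN.
  have -> : ('X + N.+1%:R%:P) ^+ n.+1 = q \Po ('X + 1).
    rewrite /q rmorphXn /= comp_polyD comp_polyX comp_polyC.
    by rewrite -addrA -polyC1 -polyCD -natr1 (addrC 1).
  have -> : umbral (q \Po ('X + 1)) = umbral q + n.+1%:R * N%:R ^+ n.
    rewrite -[LHS](subrK (umbral q)) umbral_shift addrC; congr (_ + _).
    rewrite deriv_exp !derivE addr0 mul1r hornerMn horner_exp !hornerE.
    by rewrite -mulr_natl ?add0r.
  by rewrite big_ord_recr mulrDr IHN /= addrAC.
rewrite umbralXn umbral_exprDC big_ord_recl /= bin0 subn0 expr0 mulr1 mul1r.
rewrite addrC addKr mulr_sumr; apply: eq_bigr => k _.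
rewrite /bump /= add1n subSS mulrA !mulrA.
have := mul_bin_diag n.+1 k; move/(congr1 (GRing.natmul (1 : rat))).
rewrite !natrM /= => ->.
by field; rewrite nat1r pnatr_eq0.
Qed.

Lemma umbral_XD1 (n : nat) : umbral (('X + 1) ^+ n) = bernoulli n + (n == 1)%:R.
Proof.
have := umbral_shift 'X^n; rewrite comp_Xn_poly umbralXn derivXn hornerMn hornerXn.
move/(canRL (subrK _)) => ->; rewrite addrC; congr (_ + _).
by case: n => [|[|n]]; rewrite ?mulr0n ?expr0 // expr0n mul0rn.
Qed.

(* The sequence e_n = L((-1-X)^n) satisfies the recursion that defines B_n. *)
Lemma bernoulli_reflect (n : nat) :
  (-1) ^+ n * (bernoulli n + (n == 1)%:R) = bernoulli n.
Proof.
pose e n := umbral ((- 1 - 'X) ^+ n).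
have eE k : e k = (-1) ^+ k * (bernoulli k + (k == 1)%:R).
  rewrite -umbral_XD1 /e -opprD addrC [X in umbral X]exprNn.
  by rewrite raddfMsign.
rewrite -eE; elim/ltn_ind: n => n IHn.
have rec : \sum_(i < n.+1) 'C(n.+1, i)%:R * e i = (n.+1 == 1)%:R.
  (* Expanding this power of -X binomially gives the sum of all C(n+1,i) e_i; its top term cancels
     the right-hand side except for the correction at n = 0. *)
  have : umbral ((1 + (- 1 - 'X)) ^+ n.+1) = (-1) ^+ n.+1 * bernoulli n.+1.
    rewrite addrA subrr add0r [X in umbral X]exprNn.
    by rewrite raddfMsign /= umbralXn.
  rewrite exprDn raddf_sum big_ord_recr /= binn expr1n mul1r mulr1n -/(e _) eE.
  rewrite mulrDr [X in _ + X]addrC addrA => /(canRL (addrK _)); rewrite subrr.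
  move/(canRL (addrK _)); rewrite sub0r.
  under eq_bigr do rewrite expr1n mul1r raddfMn /= -/(e _) -mulr_natl.
  by move=> ->; case: (n) => [|k]; rewrite ?expr1 ?mulr0 ?oppr0 // mulN1r opprK.
(* Same recursion and, by induction, same lower terms; the top coefficient n+1 is nonzero, so the
   top terms agree. *)
have := sum_bin_bernoulli n.+1; rewrite -rec !big_ord_recr /= => eq_sum.
have n1 : 'C(n.+1, n)%:R != 0 :> rat by rewrite pnatr_eq0 -lt0n bin_gt0.
apply: (mulfI n1); apply: (addrI (\sum_(i < n) 'C(n.+1, i)%:R * bernoulli i)).
by rewrite eq_sum; congr (_ + _); apply: eq_bigr => i _; rewrite IHn.
Qed.

Lemma bernoulli_odd (n : nat) : (1 < n)%N -> odd n -> bernoulli n = 0.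
Proof.
move=> n1 oddn; have := bernoulli_reflect n.
rewrite -signr_odd oddn gtn_eqF // addr0 expr1 mulN1r => /eqP.
by rewrite eq_sym -addr_eq0 -mulr2n mulrn_eq0 => /eqP.
Qed.

(** * Power sums modulo powers of p *)

(** Controls the denominators in Faulhaber's formula. Write k+1 = b p^a with b prime to p; then p^a
    <= k+1 < p^(k-j+1) gives a + j <= k. *)
Lemma pideal_exp_div (p j k : nat) : prime p -> (j <= k)%N ->
  (k.+1 < p ^ (k - j).+1)%N -> p%:R ^+ k / k.+1%:R \is a pideal p j.
Proof.
move=> pp jk lt_k.
have p0 : p%:R != 0 :> rat by rewrite pnatr_eq0 -lt0n prime_gt0.
have [b pb def_k] := pfactor_coprime pp (ltn0Sn k).
set a := logn p _ in def_k.
have le_a : (a + j <= k)%N.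
  have p1 := prime_gt1 pp.
  suff : (a < (k - j).+1)%N by lia.
  rewrite -(ltn_exp2l _ _ p1) (leq_ltn_trans _ lt_k) // def_k leq_pmull //.
  by case: (b) def_k.
have b0 : b%:R != 0 :> rat by rewrite pnatr_eq0; case: (b) def_k.
rewrite def_k natrM natrX -(subnK le_a) !exprD qualifE /pideal_pred.
have -> : p%:R ^+ (k - (a + j)) * (p%:R ^+ a * p%:R ^+ j) / (b%:R * p%:R ^+ a) / p%:R ^+ j
   = p%:R ^+ (k - (a + j)) * b%:R^-1 :> rat.
  by field; rewrite b0 !expf_neq0.
by rewrite rpredM ?plocal_natV // rpredX // rpred_nat.
Qed.

(** Faulhaber's formula at N = p. The grouping pairs p with each Bernoulli number, since p B_j is
    p-local even when B_j is not. *)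
Lemma powsum_bernoulli (p n : nat) :
  \sum_(k < p) k%:R ^+ n - p%:R * bernoulli n =
  \sum_(k < n) 'C(n, k.+1)%:R * (p%:R * bernoulli (n - k.+1))
                * (p%:R ^+ k.+1 / k.+2%:R).
Proof.
rewrite faulhaber big_ord_recl /= bin0 subn0 mul1r expr1 divr1 mulrC addrC addKr.
by apply: eq_bigr => k _; rewrite /bump add1n /= (exprS _ k.+1); ring.
Qed.

(** A weak form of von Staudt-Clausen: p B_n is an integer minus terms that involve p B_j with j < n
    and the p-local p^(k+1)/(k+2). *)
Lemma plocal_mulp_bernoulli (p n : nat) : prime p -> p%:R * bernoulli n \is a plocal p.
Proof.
move=> pp; elim/ltn_ind: n => n IHn.
rewrite -[_ * _](subKr (\sum_(k < p) k%:R ^+ n)) powsum_bernoulli.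
rewrite rpredB ?rpred_sum // => k _; first by rewrite rpredX ?rpred_nat.
apply: rpredM.
  by rewrite rpredM ?rpred_nat // IHn //; have := ltn_ord k; lia.
rewrite -pideal0 pideal_exp_div // subn0.
by rewrite (leq_trans (ltn_expl _ (prime_gt1 pp))) // leq_exp2l ?prime_gt1.
Qed.

(** For p > 2 one has k+2 < p^(k+1), so p divides p^(k+1)/(k+2). *)
Lemma powsum_bernoulli_mod1 (p n : nat) : prime p -> (2 < p)%N ->
  \sum_(k < p) k%:R ^+ n - p%:R * bernoulli n \is a pideal p 1.
Proof.
move=> pp p2; rewrite powsum_bernoulli rpred_sum // => k _.
apply: pidealMl; first by rewrite rpredM ?rpred_nat ?plocal_mulp_bernoulli.
apply: pideal_exp_div => //; rewrite subn1 /=.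
elim: (nat_of_ord k) => [|m IHm]; first by rewrite expn1.
by rewrite expnS (leq_trans _ (leq_mul p2 (leqnn _))) //; lia.
Qed.

(** The recursion only divides by r+1 and smaller numbers, all units mod p. *)
Lemma plocal_bernoulli_small (p r : nat) : prime p -> (r.+1 < p)%N ->
  bernoulli r \is a plocal p.
Proof.
move=> pp; elim/ltn_ind: r => r IHr ltrp.
have r1 : r.+1%:R != 0 :> rat by rewrite pnatr_eq0.
have := sum_bin_bernoulli r.+1; rewrite big_ord_recr /= binSn => rec.
rewrite -[bernoulli r](mulKf r1).
rewrite rpredM ?plocal_natV //.
  by rewrite prime_coprime // gtnNdvd.
rewrite -[_ * _](addKr (\sum_(i < r) 'C(r.+1, i)%:R * bernoulli i)) rec.
rewrite rpredD ?rpred_nat // rpredN rpred_sum // => i _.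
by rewrite rpredM ?rpred_nat // IHr // (leq_trans _ ltrp) // !ltnS ltnW.
Qed.

Lemma powsum_mod1 (p r : nat) : prime p -> (2 < p)%N -> bernoulli r \is a plocal p ->
  \sum_(k < p) k%:R ^+ r \is a pideal p 1.
Proof.
move=> pp p2 Br; rewrite -(subrK (p%:R * bernoulli r) (\sum_(k < p) _)).
rewrite rpredD ?powsum_bernoulli_mod1 // pidealMr // -[p%:R]expr1.
by rewrite pideal_expn ?prime_gt0.
Qed.

Lemma fermat_pideal (p x : nat) : prime p -> coprime p x ->
  x%:R ^+ p.-1 - 1 \is a pideal p 1.
Proof.
move=> pp px; have x0 : (0 < x ^ p.-1)%N.
  by rewrite expn_gt0; case: x px => //; rewrite /coprime gcdn0 gtn_eqF // prime_gt1.
have : (x ^ p.-1 = 1 %[mod p])%N.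
  by rewrite -(Euler_exp_totient (a := x) (n := p)) ?totient_prime // coprime_sym.
move/eqP; rewrite eqn_mod_dvd // => /dvdnP[q def_q].
rewrite -natrX -(natrB _ x0) def_q natrM pidealMl ?rpred_nat // -[p%:R]expr1.
by rewrite pideal_expn ?prime_gt0.
Qed.

(** With S_n the sum of k^n over k < p, Fermat gives p B_(r+p-1) = S_(r+p-1) = S_r = 0 mod p. As r >
    0, the terms k = 0 vanish in both sums. *)
Lemma plocal_bernoulli_shift (p r : nat) : prime p -> (2 < p)%N -> (0 < r)%N ->
  (r.+1 < p)%N -> bernoulli (r + p.-1) \is a plocal p.
Proof.
move=> pp p2 r0 ltrp.
have := powsum_bernoulli_mod1 (r + p.-1) pp p2.
have := powsum_mod1 pp p2 (plocal_bernoulli_small pp ltrp).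
move: (bernoulli _) => b S1 S2.
have p_gt0 := prime_gt0 pp.
rewrite -pideal0 -(pidealMp (p := p) 0 1) // expr1.
rewrite -[_ * _](subKr (\sum_(k < p) k%:R ^+ (r + p.-1))) rpredB //.
rewrite -[\sum_(k < p) _](subrK (\sum_(k < p) k%:R ^+ r)) rpredD //.
rewrite -sumrB rpred_sum // => -[[|k] ltkp] _ /=.
  by rewrite !expr0n addn_eq0 (gtn_eqF r0) subrr rpred0.
rewrite exprD -[X in _ - X]mulr1 -mulrBr pidealMl //.
  by rewrite rpredX ?rpred_nat.
by rewrite fermat_pideal // prime_coprime // gtnNdvd.
Qed.

(** The first error term contains B_(m+2), which vanishes by parity; the second is p^3 C(m+3,2)
    B_(m+1)/3; in all later ones p^(k+1)/(k+2) with k >= 2 is divisible by p^3, because k+2 <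
    p^(k-1) for p > 4. *)
Lemma powsum_bernoulli_mod3 (p m : nat) : prime p -> (4 < p)%N -> odd m ->
  bernoulli m.+1 \is a plocal p ->
  \sum_(k < p) k%:R ^+ m.+3 - p%:R * bernoulli m.+3 \is a pideal p 3.
Proof.
move=> pp p4 odd_m Bm; have p_gt0 := prime_gt0 pp.
rewrite powsum_bernoulli 2!big_ord_recl /= /bump /= !add1n !subSS !subn0.
rewrite bernoulli_odd //= ?negbK // mulr0 mulr0 mul0r add0r rpredD //.
  rewrite (_ : _ * _ = p%:R ^+ 3 * ('C(m.+3, 2)%:R * bernoulli m.+1 * 3%:R^-1)); last first.
    by ring.
  rewrite pidealMr ?pideal_expn // !rpredM ?rpred_nat ?plocal_natV //.
  by rewrite prime_coprime // gtnNdvd // ltnW.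
rewrite rpred_sum // => k _; rewrite !add1n.
apply: pidealMl; first by rewrite rpredM ?rpred_nat ?plocal_mulp_bernoulli.
apply: pideal_exp_div => //; rewrite !subSS subn0.
elim: (nat_of_ord k) => [|j IHj]; first by rewrite expn1.
by rewrite expnS (leq_trans _ (leq_mul p4 (leqnn _))) //; lia.
Qed.

(** * Kummer congruences *)

(** For p = 2h+1: the doubles up to 2h cancel against the even residues, and the larger ones are m +
    p with m < p odd. *)
Lemma sum_double_diff (f : nat -> rat) (h : nat) :
  \sum_(j < h.*2) f j.+1.*2 - \sum_(j < h.*2) f j.+1 =
  \sum_(j < h) (f (j.*2.+1 + h.*2.+1)%N - f j.*2.+1).
Proof.
have -> : \sum_(j < h.*2) f j.+1 = \sum_(j < h) (f j.*2.+1 + f j.+1.*2).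
  elim: h => [|h IHh]; first by rewrite !big_ord0.
  by rewrite doubleS !big_ord_recr /= IHh doubleS addrA.
have -> : \sum_(j < h.*2) f j.+1.*2 =
    \sum_(j < h) f j.+1.*2 + \sum_(j < h) f (j.*2.+1 + h.*2.+1)%N.
  rewrite -addnn big_split_ord /=; congr (_ + _); apply: eq_bigr => j _.
  by congr f; lia.
by rewrite sumrB big_split /=; ring.
Qed.

(* x^n for n = i (p-1) - 2, including the negative exponent n = -2 at i = 0. *)
Definition powm2 (p i : nat) (x : rat) : rat := (x ^+ p.-1) ^+ i / x ^+ 2.

(** The exponent n = i(p-1) - 2 of [powm2], taken in Q because natural subtraction would truncate at
    i = 0. *)
Definition expm2 (p i : nat) : rat := i%:R * (p%:R - 1) - 2.

Definition sum_powm2 (p i : nat) : rat := \sum_(k < p.-1) powm2 p i k.+1%:R.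

Lemma coprime_lt_prime (p k : nat) : prime p -> (0 < k)%N -> (k < p)%N -> coprime p k.
Proof. by move=> pp k0 ltkp; rewrite prime_coprime // gtnNdvd. Qed.

Lemma coprime_neq0 (p k : nat) : prime p -> coprime p k -> k%:R != 0 :> rat.
Proof.
move=> pp; rewrite pnatr_eq0; apply: contraL => /eqP ->.
by rewrite /coprime gcdn0 gtn_eqF // prime_gt1.
Qed.

Lemma plocal_powm2 (p i k : nat) : coprime p k -> powm2 p i k%:R \is a plocal p.
Proof.
move=> pk; apply: rpredM; first by rewrite !rpredX ?rpred_nat.
by rewrite -natrX plocal_natV ?coprimeXr.
Qed.

Lemma pideal_eq (p m : nat) (x y : rat) :
  x \is a pideal p m -> x = y -> y \is a pideal p m.
Proof. by move=> ? <-. Qed.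

Lemma pideal_p (p : nat) : (0 < p)%N -> p%:R \is a pideal p 1.
Proof. by move=> p0; rewrite -[p%:R]expr1 pideal_expn. Qed.

Lemma pidealX (p m n : nat) (x : rat) :
  x \is a pideal p m -> x ^+ n \is a pideal p (n * m).
Proof.
move=> px; elim: n => [|n IHn]; first by rewrite pideal0 rpred1.
by rewrite exprS mulSn pidealM.
Qed.

Lemma plocal_half (p : nat) : odd p -> 2^-1 \is a plocal p.
Proof. by move=> op; rewrite plocal_natV // coprime_sym coprime2n. Qed.

Ltac plocal_closure := repeat first
  [ done
  | match goal with
    | |- is_true (in_mem (_ - _)%R _) => apply: rpredB
    | |- is_true (in_mem (_ + _)%R _) => apply: rpredD
    | |- is_true (in_mem (- _)%R _) => apply: rpredN
    | |- is_true (in_mem (_ * _)%R _) => apply: rpredM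
    | |- is_true (in_mem (_ ^+ _)%R _) => apply: rpredX
    | |- is_true (in_mem (_%:R)%R _) => exact: rpred_nat
    | |- is_true (in_mem 1%R _) => exact: rpred1
    end
  | exact: plocal_half ].

(** Induction on N: multiplying the truncated expansion by 1 + e leaves the excess e^3 N(N-1)/2. *)
Lemma binomial_mod3 (p N : nat) (e : rat) : odd p -> e \is a pideal p 1 ->
  (1 + e) ^+ N - (1 + N%:R * e + N%:R * (N%:R - 1) / 2 * e ^+ 2) \is a pideal p 3.
Proof.
move=> op pe; have p0 : (0 < p)%N by case: p op {pe}.
have el := pideal_local p0 pe.
elim: N => [|N IHN]; first by rewrite expr0 !mul0r !addr0 subrr rpred0.
set E := (X in X \is a _) in IHN.
rewrite (_ : _ - _ = E * (1 + e) + e ^+ 3 * (N%:R * (N%:R - 1) * 2^-1)).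
  apply: rpredD; apply: pidealMr => //; first by rewrite rpredD ?rpred1.
    exact: (pidealX 3 pe).
  by rewrite !rpredM ?rpredB ?rpred_nat ?rpred1 ?plocal_half.
by rewrite /E exprS -natr1; field.
Qed.

(** Taylor expansion of (x+p)^n to second order. As n may be negative, [binomial_mod3] is applied to
    N = n+2 = i(p-1), and the result is divided by (1+e)^2, where e = p/x. *)
Lemma powm2_shift (p i k : nat) (n := expm2 p i) (x := k%:R : rat) :
  prime p -> odd p -> coprime p k ->
  powm2 p i (x + p%:R)
    - powm2 p i x * (1 + n * (p%:R / x) + n * (n - 1) / 2 * (p%:R / x) ^+ 2)
  \is a pideal p 3.
Proof.
move=> pp op pk; have p0 := prime_gt0 pp.
have pkp : coprime p (k + p) by rewrite /coprime gcdnDr.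
have x0 : x != 0 by apply: coprime_neq0 pk.
have xp0 : x + p%:R != 0 by rewrite /x -natrD; apply: coprime_neq0 pkp.
set e := p%:R / x.
have pe : e \is a pideal p 1 by rewrite pidealMr ?pideal_p ?plocal_natV.
have el := pideal_local p0 pe.
have nl : n \is a plocal p by rewrite rpredB ?rpredM ?rpredB ?rpred_nat ?rpred1.
have := binomial_mod3 (p.-1 * i) op pe; set E := (X in X \is a _) => pE.
have N_n : (p.-1 * i)%:R = n + 2 :> rat.
  by rewrite /n /expm2 subrK natrM mulrC -subn1 natrB.
(* The truncation for n times (1+e)^2 exceeds the truncation for n+2 by exactly the e^3 term
   here. *)
have -> : powm2 p i (x + p%:R) - powm2 p i x * (1 + n * e + n * (n - 1) / 2 * e ^+ 2)
   = powm2 p i x * (x / (x + p%:R)) ^+ 2 *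
     (E - e ^+ 3 * (n + n * (n - 1) + n * (n - 1) * 2^-1 * e)).
  have -> : powm2 p i (x + p%:R) =
     powm2 p i x * (x / (x + p%:R)) ^+ 2 * (1 + e) ^+ (p.-1 * i).
    have -> : 1 + e = (x + p%:R) / x by rewrite /e; field.
    rewrite /powm2 exprM !expr_div_n; field.
    by rewrite xp0 !expf_neq0.
  rewrite /E N_n.
  have -> : e = ((x + p%:R) / x) - 1 by rewrite /e; field.
  move: (powm2 _ _ _) (_ ^+ (p.-1 * i)) => a b.
  by field; rewrite x0.
have xl : x / (x + p%:R) \is a plocal p.
  by rewrite /x -natrD rpredM ?rpred_nat ?plocal_natV.
apply: pidealMl; first by rewrite rpredM ?plocal_powm2 ?rpredX.
apply: rpredB => //; apply: pidealMr; first exact: (pidealX 3 pe).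
have n1l : n - 1 \is a plocal p by rewrite rpredB ?rpred1.
move: (e) el => y yl.
by apply: rpredD; [apply: rpredD => //|]; rewrite !rpredM ?plocal_half.
Qed.

(** The two Taylor terms of (m+p)^n - m^n, divided by n p and summed over odd m < p. *)
Definition sum_odd_powm2 (p i : nat) : rat :=
  \sum_(j < p./2) (powm2 p i j.*2.+1%:R / j.*2.+1%:R
     + (expm2 p i - 1) / 2 * p%:R * (powm2 p i j.*2.+1%:R / j.*2.+1%:R ^+ 2)).

(* Doubling permutes the nonzero residues mod p: it sends them to the even
   k < p and to the m + p with m < p odd. *)
Lemma sum_powm2_double (p i : nat) : prime p -> odd p ->
  ((2 ^+ p.-1) ^+ i - 4) * sum_powm2 p i
    - 4 * (expm2 p i * p%:R) * sum_odd_powm2 p i \is a pideal p 3.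
Proof.
move=> pp op; have p0 := prime_gt0 pp.
have def_p : p = p./2.*2.+1 by rewrite -[LHS]odd_double_half op.
have def_p1 : p.-1 = p./2.*2 by rewrite {1}def_p.
have := sum_double_diff (fun k => powm2 p i k%:R) p./2.
rewrite -def_p -def_p1 -/(sum_powm2 p i) => dbl.
have dbl_w : \sum_(j < p.-1) powm2 p i j.+1.*2%:R =
    (2 ^+ p.-1) ^+ i / 4 * sum_powm2 p i.
  rewrite mulr_sumr; apply: eq_bigr => k _.
  rewrite /powm2 -mul2n natrM !exprMn; field.
  by rewrite nat1r pnatr_eq0.
rewrite dbl_w in dbl.
rewrite (_ : _ - _ = 4 * ((2 ^+ p.-1) ^+ i / 4 * sum_powm2 p i - sum_powm2 p i
   - expm2 p i * p%:R * sum_odd_powm2 p i)); last by field.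
rewrite {}dbl mulr_sumr -sumrB pidealMl ?rpred_nat // rpred_sum // => j _.
have pj : coprime p j.*2.+1.
  by rewrite coprime_lt_prime //; have := ltn_ord j; lia.
have j0 : j.*2.+1%:R != 0 :> rat by rewrite pnatr_eq0.
rewrite natrD; apply: (pideal_eq (powm2_shift i pp op pj)).
by move: (j.*2.+1%:R) j0 => x x0; field.
Qed.

Lemma expm2_0 (p : nat) : expm2 p 0 = - 2.
Proof. by rewrite /expm2 mul0r sub0r. Qed.

(** Termwise: going from i = 1 to i = 2 multiplies m^(n-1) by m^(p-1), which is 1 mod p; the other
    Taylor term carries a factor p. *)
Lemma sum_odd_powm2_diff1 (p : nat) : prime p -> odd p ->
  sum_odd_powm2 p 2 - sum_odd_powm2 p 1 \is a pideal p 1.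
Proof.
move=> pp op; rewrite -sumrB rpred_sum // => j _.
have pj : coprime p j.*2.+1.
  by rewrite coprime_lt_prime //; have := ltn_ord j; lia.
have j0 : j.*2.+1%:R != 0 :> rat by rewrite pnatr_eq0.
have p0 := prime_gt0 pp.
set x := j.*2.+1%:R in j0 *.
have xl : x^-1 \is a plocal p by rewrite plocal_natV.
have yl : x ^+ p.-1 \is a plocal p by rewrite rpredX ?rpred_nat.
have pv := fermat_pideal pp pj; rewrite -/x in pv.
apply: (@pideal_eq _ _ ((x ^+ p.-1 - 1) * (x ^+ p.-1 * x^-1 ^+ 3) + p%:R *
   (2^-1 * x^-1 ^+ 4 * x ^+ p.-1 * ((2 * p%:R - 5) * x ^+ p.-1 - (p%:R - 4))))).
  by apply: rpredD; apply: pidealMr; rewrite ?pideal_p //; plocal_closure.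
by rewrite /powm2 /expm2; move: (x ^+ p.-1) (x) j0 => y z z0; field.
Qed.

(** Termwise, with y = m^(p-1): the first Taylor term gives (y-1)^2 / m^3. In the second, the
    coefficients n-1 are in arithmetic progression, so their second difference weighted by y^i
    vanishes at y = 1 and yields p (y-1). *)
Lemma sum_odd_powm2_diff2 (p : nat) : prime p -> odd p ->
  sum_odd_powm2 p 0 - 2 * sum_odd_powm2 p 1 + sum_odd_powm2 p 2 \is a pideal p 2.
Proof.
move=> pp op; rewrite mulr_sumr -sumrB -big_split rpred_sum //= => j _.
have pj : coprime p j.*2.+1.
  by rewrite coprime_lt_prime //; have := ltn_ord j; lia.
have j0 : j.*2.+1%:R != 0 :> rat by rewrite pnatr_eq0.
have p0 := prime_gt0 pp.
set x := j.*2.+1%:R in j0 *.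
have xl : x^-1 \is a plocal p by rewrite plocal_natV.
have yl : x ^+ p.-1 \is a plocal p by rewrite rpredX ?rpred_nat.
have pv := fermat_pideal pp pj; rewrite -/x in pv.
apply: (@pideal_eq _ _ ((x ^+ p.-1 - 1) ^+ 2 * x^-1 ^+ 3 + p%:R * (x ^+ p.-1 - 1) *
   (2^-1 * x^-1 ^+ 4 * ((2 * p%:R - 2) + (2 * p%:R - 5) * (x ^+ p.-1 - 1))))).
  apply: rpredD; apply: pidealMr.
  - exact: (pidealX 2 pv).
  - by rewrite rpredX.
  - exact: (pidealM (pideal_p p0) pv).
  - by plocal_closure.
by rewrite /powm2 /expm2; move: (x ^+ p.-1) (x) j0 => y z z0; field.
Qed.

(** This is c_n for n = i(p-1) - 2: a substitute for B_n / n that also makes sense at n = -2. *)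
Definition kummer_quot (p i : nat) : rat := sum_powm2 p i / (expm2 p i * p%:R).

Lemma kummer_quot_double (p i : nat) : prime p -> odd p -> expm2 p i != 0 ->
  (expm2 p i)^-1 \is a plocal p ->
  ((2 ^+ p.-1) ^+ i - 4) * kummer_quot p i - 4 * sum_odd_powm2 p i \is a pideal p 2.
Proof.
move=> pp op n0 nl; have p0 := prime_gt0 pp.
have p0' : p%:R != 0 :> rat by rewrite pnatr_eq0 -lt0n.
rewrite -(pidealMp 2 1) // expr1.
apply: (pideal_eq (pidealMr (sum_powm2_double i pp op) nl)).
rewrite /kummer_quot; move: (2 ^+ _ ^+ _) => u.
by field; rewrite ?n0 ?p0'.
Qed.

(* The factors 4 (2^n - 1) = u^i - 4, u = 2^(p-1), have first and second
   differences divisible by p and p^2, so these congruences pass from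
   [sum_odd_powm2] to [kummer_quot]. *)
Lemma kummer_quot_diff1 (p : nat) : prime p -> odd p ->
  3^-1 \is a plocal p ->
  (forall i, (i < 3)%N -> expm2 p i != 0 /\ (expm2 p i)^-1 \is a plocal p) ->
  kummer_quot p 1 \is a plocal p -> kummer_quot p 2 \is a plocal p ->
  kummer_quot p 2 - kummer_quot p 1 \is a pideal p 1.
Proof.
move=> pp op l3 nl c1l c2l; have p0 := prime_gt0 pp.
have p2 : coprime p 2 by rewrite coprime_sym coprime2n.
have pt := fermat_pideal pp p2.
have [n1 n1l] := nl 1 isT; have [n2 n2l] := nl 2 isT.
have h1 := kummer_quot_double pp op n1 n1l.
have h2 := kummer_quot_double pp op n2 n2l.
have /pideal_sub h := rpredB h2 h1.
have {h}h := h 1 p0 isT.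
have hF := sum_odd_powm2_diff1 pp op.
set u := _ ^+ p.-1 in pt h; set c1 := kummer_quot p 1 in c1l h *.
set c2 := kummer_quot p 2 in c2l h *.
have ul : u \is a plocal p by rewrite rpredX ?rpred_nat.
(* Since u = 1 mod p, the factors u^i - 4 are -3 mod p; this is why 3 must be inverted. *)
apply: (@pideal_eq _ _ (((u - 1) * ((u + 1) * c2 - c1) - 4 *
  (sum_odd_powm2 p 2 - sum_odd_powm2 p 1) - ((u ^+ 2 - 4) * c2 - 4 * sum_odd_powm2 p 2
  - ((u ^+ 1 - 4) * c1 - 4 * sum_odd_powm2 p 1))) * 3^-1)); last by field.
apply: pidealMr => //; apply: rpredB => //; apply: rpredB.
  by apply: pidealMr => //; plocal_closure.
by apply: pidealMl; rewrite ?rpred_nat.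
Qed.

Lemma kummer_quot_diff2 (p : nat) : prime p -> odd p ->
  3^-1 \is a plocal p ->
  (forall i, (i < 3)%N -> expm2 p i != 0 /\ (expm2 p i)^-1 \is a plocal p) ->
  kummer_quot p 1 \is a plocal p -> kummer_quot p 2 \is a plocal p ->
  kummer_quot p 0 - 2 * kummer_quot p 1 + kummer_quot p 2 \is a pideal p 2.
Proof.
move=> pp op l3 nl c1l c2l; have p0 := prime_gt0 pp.
have p2 : coprime p 2 by rewrite coprime_sym coprime2n.
have pt := fermat_pideal pp p2.
have hc := kummer_quot_diff1 pp op l3 nl c1l c2l.
have [n0 n0l] := nl 0 isT; have [n1 n1l] := nl 1 isT; have [n2 n2l] := nl 2 isT.
have h0 := kummer_quot_double pp op n0 n0l.
have h1 := kummer_quot_double pp op n1 n1l.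
have h2 := kummer_quot_double pp op n2 n2l.
have hF := sum_odd_powm2_diff2 pp op.
set u := _ ^+ p.-1 in pt h0 h1 h2; set c0 := kummer_quot p 0 in h0 *.
set c1 := kummer_quot p 1 in c1l h1 hc *.
set c2 := kummer_quot p 2 in c2l h2 hc *.
set F0 := sum_odd_powm2 p 0 in h0 hF; set F1 := sum_odd_powm2 p 1 in h1 hF.
set F2 := sum_odd_powm2 p 2 in h2 hF.
(* Product rule for the second difference of u^i c_i; the cross term 2(u-1)(c2-c1) needs the
   first-difference congruence. *)
apply: (@pideal_eq _ _ ((2 * ((u - 1) * (c2 - c1)) + (u - 1) ^+ 2 * c2
  - 4 * (F0 - 2 * F1 + F2)
  - (((u ^+ 0 - 4) * c0 - 4 * F0) - 2 * ((u ^+ 1 - 4) * c1 - 4 * F1)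
     + ((u ^+ 2 - 4) * c2 - 4 * F2))) * 3^-1)); last by field.
apply: pidealMr => //; apply: rpredB; first apply: rpredB; first apply: rpredD.
- by apply: pidealMl; [rewrite rpred_nat | apply: (pidealM pt hc)].
- by apply: pidealMr => //; apply: (pidealX 2 pt).
- by apply: pidealMl; rewrite ?rpred_nat.
- by apply: rpredD => //; apply: rpredB => //; apply: pidealMl; rewrite ?rpred_nat.
Qed.

(** * The Apery sum *)

Lemma sum_powm2E (p i : nat) : (3 < p)%N -> (0 < i)%N ->
  sum_powm2 p i = \sum_(k < p) k%:R ^+ (i * p.-1 - 2).
Proof.
case: p => // p p3 i0; rewrite big_ord_recl /= expr0n.
(* Here [p] stands for the predecessor of the prime; the exponent is positive, so the term k = 0 is
   0. *)
have ip : (2 < i * p)%N by rewrite (leq_trans _ (leq_mul i0 (leqnn p))) // mul1n.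
rewrite gtn_eqF ?subn_gt0 // add0r; apply: eq_bigr => k _.
rewrite /powm2 /bump add1n /= -exprM mulnC -{1}(subnK (ltnW ip)) exprD mulfK //.
by rewrite expf_neq0 // pnatr_eq0.
Qed.

(** * Harmonic sums modulo p and p^2, and the Apery sum in terms of them *)

Definition harmonic (p s : nat) : rat := \sum_(k < p.-1) k.+1%:R ^- s.

(** By Fermat, k^(-s) = k^(p-1-s) mod p, and the power sum of exponent p-1-s vanishes mod p because
    B_(p-1-s) is p-local. *)
Lemma harmonic_mod1 (p s : nat) : prime p -> (2 < p)%N -> (0 < s)%N -> (s.+1 < p)%N ->
  harmonic p s \is a pideal p 1.
Proof.
move=> pp p2 s0 ltsp.
have Sr : \sum_(k < p) k%:R ^+ (p.-1 - s) \is a pideal p 1.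
  by apply: powsum_mod1 => //; apply: plocal_bernoulli_small => //; lia.
apply: (@pideal_eq _ _ (\sum_(k < p) k%:R ^+ (p.-1 - s)
  - \sum_(k < p.-1) (k.+1%:R ^+ p.-1 - 1) * k.+1%:R ^- s)).
  apply: rpredB => //; apply: rpred_sum => k _.
  have pk : coprime p k.+1.
    by rewrite coprime_lt_prime //; have := ltn_ord k; lia.
  by rewrite pidealMr ?fermat_pideal // -natrX plocal_natV ?coprimeXr.
apply/eqP; rewrite subr_eq /harmonic -big_split /=; apply/eqP.
have def_p := prednK (prime_gt0 pp).
rewrite -[in LHS]def_p big_ord_recl /= expr0n gtn_eqF ?add0r; last by lia.
apply: eq_bigr => k _; rewrite /bump add1n.
have k0 : k.+1%:R != 0 :> rat by rewrite pnatr_eq0.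
have les : (s <= p.-1)%N by lia.
have -> : k.+1%:R ^+ p.-1 = k.+1%:R ^+ (p.-1 - s) * k.+1%:R ^+ s :> rat.
  by rewrite -exprD subnK.
rewrite mulrBl mulfK ?expf_neq0 // mul1r.
by rewrite addrC subrK.
Qed.

(** Pairing k with p-k: 1/k^3 + 1/(p-k)^3 = -3p/k^4 mod p^2, and H_4 = 0 mod p. *)
Lemma harmonic3_mod2 (p : nat) : prime p -> (6 < p)%N ->
  harmonic p 3 \is a pideal p 2.
Proof.
move=> pp p6; have p0 := prime_gt0 pp.
have op : odd p by case: (even_prime pp) p6 => [->|].
have H4 : harmonic p 4 \is a pideal p 1 by apply: harmonic_mod1 => //; lia.
apply: (@pideal_eq _ _ (2^-1 * (\sum_(k < p.-1)
   (k.+1%:R ^- 3 + (p%:R - k.+1%:R) ^- 3 + 3 * p%:R * k.+1%:R ^- 4)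
   - 3 * (p%:R * harmonic p 4)))); last first.
  rewrite !big_split /= -[X in _ + _ + X]mulr_sumr -/(harmonic p 4) -/(harmonic p 3).
  rewrite (reindex_inj rev_ord_inj) /=.
  rewrite (eq_bigr (fun k : 'I_p.-1 => k.+1%:R ^- 3)) => [|k _]; last first.
    have lt_kp := ltn_ord k.
    rewrite -natrB; last by lia.
    by congr (_%:R ^- 3); lia.
  by rewrite -/(harmonic p 3); field.
apply: pidealMl; first exact: plocal_half.
apply: rpredB; last first.
  by apply: pidealMl; [rewrite rpred_nat | apply: (pidealM (pideal_p p0) H4)].
apply: rpred_sum => k _; have lt_kp := ltn_ord k.
have pk : coprime p k.+1 by rewrite coprime_lt_prime //; lia.
have pk' : coprime p (p - k.+1) by rewrite coprime_lt_prime //; lia.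
have k0 := coprime_neq0 pp pk; have k0' := coprime_neq0 pp pk'.
have kl := plocal_natV pk; have kl' := plocal_natV pk'.
have xl : k.+1%:R \is a plocal p by rewrite rpred_nat.
rewrite natrB in k0' kl'; last by lia.
set x := k.+1%:R in k0 k0' kl kl' xl *.
apply: (@pideal_eq _ _ (p%:R ^+ 2 * ((3 * p%:R ^+ 2 - 8 * p%:R * x + 6 * x ^+ 2)
   * (x^-1 ^+ 4 * (p%:R - x)^-1 ^+ 3)))).
  by apply: pidealMr; [apply: pideal_expn | plocal_closure].
move: (x) (k0) (k0') => y y0 y0'.
by field; rewrite y0 y0'.
Qed.

(** Newton's identity for the second elementary symmetric function; it evaluates the double sum in
    the Apery expansion. *)
Lemma sum_lt_pairs (a : nat -> rat) (n : nat) :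
  2 * (\sum_(k < n) a k * \sum_(j < k) a j) =
  (\sum_(k < n) a k) ^+ 2 - \sum_(k < n) a k ^+ 2.
Proof.
elim: n => [|n IHn]; first by rewrite !big_ord0; ring.
by rewrite !big_ord_recr /= mulrDr IHn; ring.
Qed.

Definition apery_prod (p k : nat) : rat := \prod_(j < k) (1 - p%:R ^+ 2 / j.+1%:R ^+ 2).

(** Induction on k: both sides get multiplied by (p-k-2)(p+k+1)/(k+2)^2 when k increases by one. *)
Lemma apery_factor (p k : nat) : (k.+1 < p)%N ->
  ('C(p.-1, k.+1) * 'C(p.-1 + k.+1, k.+1))%:R =
  (-1) ^+ k * (p%:R * (p%:R - k.+1%:R) / k.+1%:R ^+ 2) * apery_prod p k :> rat.
Proof.
case: p => // p; elim: k => [|k IHk] ltkp /=.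
  rewrite addn1 bin1 bin1 /apery_prod big_ord0 natrM expr0 expr1n -(natr1 p); field.
  by [].
have k1 : k.+2%:R != 0 :> rat by rewrite pnatr_eq0.
have k0 : k.+1%:R != 0 :> rat by rewrite pnatr_eq0.
apply: (mulfI k1); apply: (mulfI k1).
have -> : k.+2%:R * (k.+2%:R * ('C(p, k.+2) * 'C(p + k.+2, k.+2))%:R) =
   (p%:R - k.+1%:R) * (p.+1%:R + k.+1%:R) * ('C(p, k.+1) * 'C(p + k.+1, k.+1))%:R :> rat.
  rewrite -natrB; last by lia.
  rewrite -natrD -!natrM mulnA mulnACA mul_bin_left.
  have := mul_bin_diag (p + k.+2) k.+1; rewrite addnS /= => <-.
  by congr (_%:R); rewrite mulnACA !addnS addSn.
rewrite IHk 1?ltnW //= /apery_prod big_ord_recr /= (exprS (-1)).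
move: (\prod_(j < k) _) => R.
rewrite -!(natr1 k.+1) -!(natr1 p) in k1 *.
move: (k.+1%:R) k0 k1 => x x0 x1; move: ((-1) ^+ k) => s.
by field; rewrite x0 x1.
Qed.

(** Each factor squared is 1 - 2p^2/j^2 up to p^4. Modulus p^3 suffices, since every Apery term with
    k > 0 carries a further p^2. *)
Lemma apery_prod_sqr (p k : nat) : prime p -> (k < p)%N ->
  apery_prod p k ^+ 2 - (1 - 2 * p%:R ^+ 2 * \sum_(j < k) j.+1%:R ^- 2)
  \is a pideal p 3.
Proof.
move=> pp; have p0 := prime_gt0 pp; rewrite /apery_prod.
elim: k => [|k IHk] ltkp.
  by rewrite !big_ord0 mulr0 subr0 expr1n subrr rpred0.
have pk : coprime p k.+1 by rewrite coprime_lt_prime.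
have k0 := coprime_neq0 pp pk; have kl := plocal_natV pk.
have {IHk} := IHk (ltnW ltkp); rewrite !big_ord_recr /=.
have hl : \sum_(j < k) j.+1%:R ^- 2 \is a plocal p.
  apply: rpred_sum => j _; rewrite -natrX plocal_natV ?coprimeXr ?coprime_lt_prime //.
  by have := ltn_ord j; lia.
move: (\prod_(j < k) _) (\sum_(j < k) _) hl => R h hl.
set E := (X in X \is a _) => pE.
set x := k.+1%:R in k0 kl *.
apply: (@pideal_eq _ _ (E * (1 - p%:R ^+ 2 * x^-1 ^+ 2) ^+ 2 + p%:R ^+ 4 *
   (x^-1 ^+ 4 + 4 * h * x^-1 ^+ 2 - 2 * p%:R ^+ 2 * h * x^-1 ^+ 4))).
  apply: rpredD; first by apply: pidealMr => //; plocal_closure.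
  apply: pidealMr; last by plocal_closure.
  by apply: (@pideal_sub _ 3 4) => //; apply: pideal_expn.
by rewrite /E; move: (x) (k0) => y y0; field.
Qed.

Lemma apery_harmonic (p : nat) : prime p -> (6 < p)%N ->
  (apery p.-1)%:R - (1 + p%:R ^+ 2 * harmonic p 2) \is a pideal p 5.
Proof.
move=> pp p6; have p0 := prime_gt0 pp.
pose h k := \sum_(j < k) j.+1%:R ^- 2 : rat.
pose T (k : nat) : rat := (p%:R - k.+1%:R) ^+ 2 / k.+1%:R ^+ 4 * apery_prod p k ^+ 2.
have -> : (apery p.-1)%:R = 1 + p%:R ^+ 2 * \sum_(k < p.-1) T k :> rat.
  rewrite /apery big_ord_recl /= !bin0 !exp1n mul1n natrD; congr (_ + _).
  rewrite natr_sum mulr_sumr; apply: eq_bigr => k _; rewrite /bump add1n.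
  have ltkp : (k.+1 < p)%N by have := ltn_ord k; lia.
  rewrite -expnMn natrX apery_factor // !exprMn sqrr_sign mul1r /T.
  by move: (apery_prod _ _) => R; field; rewrite nat1r pnatr_eq0.
have -> : 1 + p%:R ^+ 2 * \sum_(k < p.-1) T k - (1 + p%:R ^+ 2 * harmonic p 2)
  = p%:R ^+ 2 * (\sum_(k < p.-1) T k - harmonic p 2) by ring.
rewrite (pidealMp 3 2) //.
have H2 : harmonic p 2 \is a pideal p 1 by apply: harmonic_mod1 => //; lia.
have H4 : harmonic p 4 \is a pideal p 1 by apply: harmonic_mod1 => //; lia.
have H3 := harmonic3_mod2 pp p6.
have H2l := pideal_local p0 H2.
(* Expanding [T] mod p^3 and summing gives H_2 - 2p H_3 + p^2 (2 H_4 - H_2^2); the double sum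
   contributes H_4 - H_2^2. *)
apply: (@pideal_eq _ _ (\sum_(k < p.-1) (T k - (k.+1%:R ^- 2 - 2 * p%:R * k.+1%:R ^- 3
     + p%:R ^+ 2 * k.+1%:R ^- 4 - p%:R ^+ 2 * (2 * (k.+1%:R ^- 2 * h k))))
  - 2 * (p%:R * harmonic p 3) + p%:R ^+ 2 * (2 * harmonic p 4 - harmonic p 2 ^+ 2))); last first.
  have := sum_lt_pairs (fun k => k.+1%:R ^- 2) p.-1.
  rewrite -/(harmonic p 2) => pairs.
  have {}pairs : 2 * (\sum_(k < p.-1) k.+1%:R ^- 2 * h k) = harmonic p 2 ^+ 2 - harmonic p 4.
    rewrite pairs; congr (_ - _); apply: eq_bigr => k _.
    by rewrite -exprVn -exprM exprVn.
  rewrite sumrB sumrB big_split sumrB /= -!mulr_sumr pairs.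
  rewrite -/(harmonic p 2) -/(harmonic p 3) -/(harmonic p 4).
  by ring.
apply: rpredD; last first.
  apply: (pidealM (pideal_expn 2 p0)); apply: rpredB.
    by apply: pidealMl; rewrite ?rpred_nat.
  by rewrite expr2; apply: pidealMr.
apply: rpredB; last first.
  by apply: pidealMl; [rewrite rpred_nat | apply: (pidealM (pideal_p p0) H3)].
apply: rpred_sum => k _; have lt_kp := ltn_ord k.
have ltkp : (k < p)%N by lia.
have := apery_prod_sqr pp ltkp; rewrite -/(h k) /T.
have pk : coprime p k.+1 by rewrite coprime_lt_prime //; lia.
have k0 := coprime_neq0 pp pk; have kl := plocal_natV pk.
have xl : k.+1%:R \is a plocal p by rewrite rpred_nat.
have hl : h k \is a plocal p.
  apply: rpred_sum => j _; rewrite -natrX plocal_natV ?coprimeXr ?coprime_lt_prime //.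
  by have := ltn_ord j; lia.
set E := (X in X \is a _) => pE.
set x := k.+1%:R in k0 kl xl *.
apply: (@pideal_eq _ _ (E * ((p%:R - x) ^+ 2 * x^-1 ^+ 4) + p%:R ^+ 3 *
   (2 * h k * (2 * x - p%:R) * x^-1 ^+ 4))).
  apply: rpredD; first by apply: pidealMr => //; plocal_closure.
  by apply: pidealMr; [apply: pideal_expn | plocal_closure].
by rewrite /E; move: (x) (k0) (h k) (apery_prod _ _) => y y0 h' R; field.
Qed.

(** * H_2 modulo p^3 through Bernoulli numbers, and the conclusion *)

Lemma expm2_unit (p i : nat) : prime p -> (6 < p)%N -> (i < 3)%N ->
  expm2 p i != 0 /\ (expm2 p i)^-1 \is a plocal p.
Proof.
move=> pp p6; have op : odd p by case: (even_prime pp) p6 => [->|].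
case: i => [|[|[|//]]] _.
- by rewrite expm2_0 invrN rpredN plocal_half.
- rewrite (_ : expm2 p 1 = (p - 3)%:R); last by rewrite /expm2 natrB //; [ring | lia].
  by rewrite pnatr_eq0 plocal_natV ?coprime_lt_prime //; lia.
- rewrite (_ : expm2 p 2 = 2 * (p - 2)%:R); last by rewrite /expm2 natrB //; [ring | lia].
  rewrite mulf_neq0 ?pnatr_eq0 //; last by lia.
  by rewrite invfM rpredM ?plocal_half ?plocal_natV ?coprime_lt_prime //; lia.
Qed.

(** The exponents are n = p-3 and n = 2p-4. The congruence also needs B_(n-2) to be p-local, that is
    B_(p-5) and B_(2p-6), the latter as a shift of the former by p-1. *)
Lemma sum_powm2_bernoulli (p i : nat) : prime p -> (6 < p)%N -> i \in [:: 1; 2]%N ->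
  bernoulli (i * p.-1 - 2) \is a plocal p /\
  sum_powm2 p i - p%:R * bernoulli (i * p.-1 - 2) \is a pideal p 3.
Proof.
move=> pp p6 i12; have op : odd p by case: (even_prime pp) p6 => [->|].
have i0 : (0 < i)%N by move: i12; rewrite !inE => /orP[] /eqP ->.
rewrite sum_powm2E //; last by lia.
have -> : (i * p.-1 - 2 = (i * p.-1 - 5).+3)%N.
  by have := leq_mul i0 (leqnn p.-1); lia.
split; last apply: powsum_bernoulli_mod3 => //; try lia.
- move: i12; rewrite !inE => /orP[] /eqP ->.
    by apply: plocal_bernoulli_small => //; lia.
  have -> : ((2 * p.-1 - 5).+3 = p - 3 + p.-1)%N by lia.
  by apply: plocal_bernoulli_shift => //; lia.
- move: i12; rewrite !inE => /orP[] /eqP ->.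
    by apply: plocal_bernoulli_small => //; lia.
  have -> : ((2 * p.-1 - 5).+1 = p - 5 + p.-1)%N by lia.
  by apply: plocal_bernoulli_shift => //; lia.
Qed.

Lemma harmonic2_mod3 (p : nat) : prime p -> (6 < p)%N ->
  harmonic p 2 - (p%:R * (4 / 3 * bernoulli (p - 3) - 1 / 2 * bernoulli (2 * p - 4))
    + 1 / 9 * p%:R ^+ 2 * bernoulli (p - 3)) \is a pideal p 3.
Proof.
move=> pp p6; have op : odd p by case: (even_prime pp) p6 => [->|].
have p_gt0 := prime_gt0 pp.
have p0 : p%:R != 0 :> rat by rewrite pnatr_eq0 -lt0n.
have l3 : 3^-1 \is a plocal p by rewrite plocal_natV ?coprime_lt_prime //; lia.
have l2 := plocal_half op.
have [b1l s1] := sum_powm2_bernoulli pp p6 (i := 1) isT.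
have [b2l s2] := sum_powm2_bernoulli pp p6 (i := 2) isT.
rewrite (_ : 1 * p.-1 - 2 = p - 3)%N in b1l s1; last by lia.
rewrite (_ : 2 * p.-1 - 2 = 2 * p - 4)%N in b2l s2; last by lia.
have nl i := expm2_unit pp p6 (i := i).
have [n0 _] := nl 0 isT; have [n1 n1l] := nl 1 isT; have [n2 n2l] := nl 2 isT.
have sumE i : expm2 p i != 0 -> sum_powm2 p i = p%:R * (expm2 p i * kummer_quot p i).
  by move=> ni; rewrite /kummer_quot; field; rewrite ?ni ?p0.
have -> : harmonic p 2 = p%:R * (- 2 * kummer_quot p 0).
  rewrite -(expm2_0 p) -sumE //; apply: eq_bigr => k _.
  by rewrite /powm2 expr0 mul1r.
rewrite (sumE 1) // -mulrBr in s1; rewrite (sumE 2) // -mulrBr in s2.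
rewrite (pidealMp 2 1) // in s1; rewrite (pidealMp 2 1) // in s2.
have quotl i b : b \is a plocal p -> expm2 p i != 0 -> (expm2 p i)^-1 \is a plocal p ->
    expm2 p i * kummer_quot p i - b \is a pideal p 2 -> kummer_quot p i \is a plocal p.
  move=> bl ni nil si; rewrite -[kummer_quot p i](mulKf ni) rpredM //.
  by rewrite -[_ * _](subrK b) rpredD // (pideal_local p_gt0 si).
have c1l := quotl 1%N _ b1l n1 n1l s1; have c2l := quotl 2%N _ b2l n2 n2l s2.
have d1 := kummer_quot_diff1 pp op l3 nl c1l c2l.
have d2 := kummer_quot_diff2 pp op l3 nl c1l c2l.
set c0 := kummer_quot p 0 in d2 *; set c1 := kummer_quot p 1 in c1l s1 d1 d2.
set c2 := kummer_quot p 2 in c2l s2 d1 d2.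
set b1 := bernoulli _ in b1l s1 *; set b2 := bernoulli _ in b2l s2 *.
(* The constants come from (p-3)(4/3 + p/9) = -4 + p + p^2/9 and (2p-4)/2 = p-2: putting (p-3) c1
   for b1 and (2p-4) c2 for b2 yields -4 c1 + 2 c2 - p(c2-c1) + p^2 c1/9, to be compared with -2
   c0. *)
apply: (@pideal_eq _ _ (p%:R ^+ 1 * (- 2 * (c0 - 2 * c1 + c2) + p%:R * (c2 - c1)
  - p%:R ^+ 2 * (3^-1 ^+ 2 * c1)
  + (expm2 p 1 * c1 - b1) * (4 * 3^-1 + p%:R * 3^-1 ^+ 2)
  - (expm2 p 2 * c2 - b2) * 2^-1))); last first.
  rewrite /expm2; move: (p%:R : rat) (c0) (c1) (c2) (b1) (b2) => q x0 x1 x2 y1 y2.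
  by field.
rewrite (pidealMp 2 1) //; apply: rpredB; first apply: rpredD;
  first apply: rpredB; first apply: rpredD.
- by apply: pidealMl => //; rewrite rpredN rpred_nat.
- exact: (pidealM (pideal_p p_gt0) d1).
- by apply: pidealMr; [apply: pideal_expn | plocal_closure].
- by apply: pidealMr => //; plocal_closure.
- by apply: pidealMr.
Qed.

Unset Implicit Arguments.

Theorem theorem1p1 (p : nat) (hp : prime p) (hp7 : (7 <= p)%N) :
  rat_congr_mod p 5 (apery p.-1)%:R
    (1 + (p ^ 3)%:R * ((4%:R / 3%:R) * bernoulli (p - 3)
                        - (1 / 2%:R) * bernoulli (2 * p - 4))
       + (1 / 9%:R) * (p ^ 4)%:R * bernoulli (p - 3)).
Proof.
have p_gt0 := prime_gt0 hp.
have hA := apery_harmonic hp hp7.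
(* Multiplication by p^2 turns the congruence for H_2 mod p^3 into one mod p^5, which is then added
   to [hA]. *)
have hH := harmonic2_mod3 hp hp7; rewrite -(pidealMp 3 2) // in hH.
have [r r_local def_r] := pidealP p_gt0 (rpredD hA hH).
exists r; split; first by rewrite -prime_coprime.
by rewrite !natrX -def_r; ring.
Qed.
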